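(* Formulation F7 is equivalent to Formulation F4 (both defined in the context). Explicitly: for every instance $(T,M,(W_m)_{m\in M})$, a pair $(X,S)$ is a continuous solution of F7 if and only if it is a continuous solution of F4.
   Context: An instance of the generator maintenance scheduling problem consists of a horizon $T=\{1,2,\dots,|T|\}$ of periods, a finite nonempty set $M$ of maintenances, and a positive integer duration $W_m$ for each $m\in M$. The variables are $X_{t,m}$ (maintenance $m$ is executed in period $t$) and $S_{t,m}$ (maintenance $m$ starts in period $t$), for $t\in T$, $m\in M$. Convention: $S_{t,m}=0$ whenever $t\le 0$, $t>|T|$, or $t\ge |T|-W_m+2$ (a maintenance cannot start so late that it would not finish within the horizon). In particular every solution of either formulation is required to satisfy $S_{t,m}=0$ for $t\in T$ with $t\ge |T|-W_m+2$. Formulation F4 (variables $X,S$): $\sum_{t\in T}X_{t,m}=W_m$ for all $m\in M$; $\sum_{t\in T}S_{t,m}=1$ for all $m\in M$; $\sum_{t'=t-W_m+1}^{t}S_{t',m}\ge X_{t,m}$ for all $t\in T$, $m\in M$; $X_{t,m},S_{t,m}\in\{0,1\}$ for all $t\in T$, $m\in M$. Formulation F7 (variables $X,S$): $\sum_{t\in T}S_{t,m}=1$ for all $m\in M$; $\sum_{t'=t-W_m+1}^{t}S_{t',m}=X_{t,m}$ for all $t\in T$, $m\in M$; $X_{t,m},S_{t,m}\in\{0,1\}$ for all $t\in T$, $m\in M$. A continuous solution of a formulation is a real assignment of its variables satisfying its linear relaxation, i.e. all its constraints with each condition ''$\in\{0,1\}$'' replaced by ''$\in[0,1]$''. A formulation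 A is at least as tight as B if all continuous solutions satisfying A also satisfy B; A is equivalent to B if A is at least as tight as B and B is at least as tight as A. *)

(* Defs.v *)
From HB Require Import structures.
From mathcomp Require Import all_boot all_order all_algebra.
From mathcomp Require Import reals.
Set Implicit Arguments.
Unset Strict Implicit.
Unset Printing Implicit Defensive.
Import Order.TTheory GRing.Theory Num.Theory.
Local Open Scope ring_scope.

Record instance := Instance {
  horizon : nat;
  maint : finType;
  duration : maint -> nat;
  maint_nonempty : (0 < #|maint|)%N;
  duration_gt0 : forall m, (0 < duration m)%N
}.

(* Periods are numbered from 1: the index [t : 'I_(horizon I)] stands for the
   period [t + 1]. Period numbers are integers because the windows below may
   begin at a nonpositive number. *)
Definition period n (t : 'I_n) : int := t.+1%:Z.

Definition assignment (R : realType) (I : instance) :=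
  'I_(horizon I) -> maint I -> R.

(* S_{t,m} for an arbitrary integer t, equal to 0 outside the horizon. *)
Definition ext (R : realType) (I : instance) (S : assignment R I)
    (t : int) (m : maint I) : R :=
  if [pick i : 'I_(horizon I) | period i == t] is Some i then S i m else 0.

(* The sum of S_{t',m} for t' from t - W_m + 1 to t. *)
Definition window (R : realType) (I : instance) (S : assignment R I)
    (t : 'I_(horizon I)) (m : maint I) : R :=
  \sum_(k < duration m) ext S (period t - (duration m)%:Z + 1 + k%:Z) m.

Definition no_late_start (R : realType) (I : instance) (S : assignment R I) :=
  forall (t : 'I_(horizon I)) (m : maint I),
    (horizon I)%:Z - (duration m)%:Z + 2 <= period t -> S t m = 0.

(* A formulation is parametrized by the set of values allowed for its
   variables: {0, 1} for the formulation itself, [0, 1] for its linear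
   relaxation. *)
Definition formulation (R : realType) :=
  pred R -> forall I : instance, assignment R I -> assignment R I -> Prop.

Definition F4 (R : realType) : formulation R := fun D I X S =>
  [/\ no_late_start S,
      forall m, \sum_t X t m = (duration m)%:R,
      forall m, \sum_t S t m = 1,
      forall t m, window S t m >= X t m &
      forall t m, X t m \in D /\ S t m \in D].

Definition F7 (R : realType) : formulation R := fun D I X S =>
  [/\ no_late_start S,
      forall m, \sum_t S t m = 1,
      forall t m, window S t m = X t m &
      forall t m, X t m \in D /\ S t m \in D].

Definition integer_solution (R : realType) (F : formulation R) (I : instance)
    (X S : assignment R I) : Prop :=
  F [pred x | (x == 0) || (x == 1)] I X S.

Definition continuous_solution (R : realType) (F : formulation R)
    (I : instance) (X S : assignment R I) : Prop :=
  F [pred x | 0 <= x <= 1] I X S.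

Definition at_least_as_tight (R : realType) (A B : formulation R) : Prop :=
  forall (I : instance) (X S : assignment R I),
    continuous_solution A X S -> continuous_solution B X S.

Definition equivalent (R : realType) (A B : formulation R) : Prop :=
  at_least_as_tight A B /\ at_least_as_tight B A.

(* Main.v *)
Require Import Defs.
From mathcomp Require Import all_boot all_order all_algebra.
From mathcomp Require Import reals zify.

(** Fix a maintenance [m] of duration [W]. A start of nonzero
    weight lies in exactly [W] windows, those of the periods in which the
    maintenance would run; [no_late_start] ensures that these periods are all
    within the horizon. Double counting therefore
    gives [\sum_t window S t m = W * \sum_t S t m] ([sum_window]), which is [W]
    as soon as the starts sum to 1.

    Under F7 the window sums are the [X t m], so the demand constraint of F4
    follows. Under F4 the [X t m] are bounded termwise by the window sums, and
    both families have total [W]; so every inequality is an equality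
    ([eq_of_le_of_sum_eq]), which is the window constraint of F7. *)

Set Implicit Arguments.
Unset Strict Implicit.
Unset Printing Implicit Defensive.
Import Order.TTheory GRing.Theory Num.Theory.
Local Open Scope ring_scope.

Lemma eq_of_le_of_sum_eq (R : numDomainType) (T : finType) (f g : T -> R) :
  (forall t, f t <= g t) -> \sum_t f t = \sum_t g t -> forall t, g t = f t.
Proof.
move=> le_fg eq_fg t.
have ge0 i : true -> 0 <= g i - f i by rewrite subr_ge0 le_fg.
have sum0 : \sum_i (g i - f i) = 0 by rewrite sumrB eq_fg subrr.
by apply/eqP; rewrite -subr_eq0; apply/eqP; apply: (psumr_eq0P ge0 sum0).
Qed.

Lemma period_inj n : injective (@period n).
Proof. by move=> i j [eq_ij]; apply: val_inj. Qed.

(** In this form the order of summation over starts and periods can be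
    exchanged. *)
Lemma ext_sum (R : realType) (I : instance) (S : assignment R I) z m :
  ext S z m = \sum_(i | period i == z) S i m.
Proof.
rewrite /ext; case: pickP => [i /eqP <- | none]; last by rewrite big_pred0.
by rewrite (big_pred1 i) // => j; rewrite (inj_eq (@period_inj _)).
Qed.

(** A start [i] is met by the [k]-th term of a window for a single period [t],
    the one with index [i + W - 1 - k]; it lies in the horizon unless [i] is a
    late start, of weight 0. *)
Lemma sum_window_term (R : realType) (I : instance) (S : assignment R I) m k :
  no_late_start S -> (k < duration m)%N ->
  \sum_(t < horizon I) ext S (period t - (duration m)%:Z + 1 + k%:Z) m =
  \sum_t S t m.
Proof.
move=> late lt_kW; under eq_bigr => t _ do rewrite ext_sum.
rewrite (exchange_big_dep predT) //=; apply: eq_bigr => i _.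
have [le_iW | lt_Hi] := leqP (i + duration m) (horizon I); last first.
  have Si0 : S i m = 0 by apply: late; rewrite /period; lia.
  by rewrite Si0 big1.
have lt_tH : (i + duration m - 1 - k < horizon I)%N by lia.
rewrite (big_pred1 (Ordinal lt_tH)) // => t.
by rewrite /= -val_eqE /period /=; lia.
Qed.

Lemma sum_window (R : realType) (I : instance) (S : assignment R I) m :
  no_late_start S ->
  \sum_t window S t m = (duration m)%:R * \sum_t S t m.
Proof.
move=> late; rewrite exchange_big /=.
under eq_bigr => k _ do rewrite (sum_window_term late (ltn_ord k)).
by rewrite sumr_const card_ord mulr_natl.
Qed.

Theorem proposition3p4 (R : realType) : equivalent (@F7 R) (@F4 R).
Proof.
split=> I X S.
- case=> late start win dom; split=> // [m | t m]; last by rewrite win.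
  under eq_bigr => t _ do rewrite -win.
  by rewrite sum_window // start mulr1.
- case=> late demand start win dom; split=> // t m.
  apply: (@eq_of_le_of_sum_eq _ _ (X^~ m) (fun t => window S t m)) => //.
  by rewrite sum_window // start mulr1 demand.
Qed.
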